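(* Let $n\ge 3$ and $r\ge 2$, let $d\in\{0,1,2\}$ be the remainder of $n$ modulo $3$, and set $$n_0(r,d)=\begin{cases}8 & r=2\\ (6+d)r & r \text{ odd}\\ (12+d)r & r\ge4\text{ even.}\end{cases}$$ Then for $n\ge n_0(r,d)$ there is an equality $$\ker(\phi_r)=\Gamma_n^r,$$ i.e. $\ker(\phi_r)$ is generated by the finite set of basic $(r+1)^{st}$ twists.
   Context: $B_n$ is the braid group on $n$ strands with standard generators $\sigma_1,\dots,\sigma_{n-1}$. For $a\ge1$ with $n\ge a+r$, the basic $(r+1)^{st}$ twist is $\Sigma_{a;r}=\sigma_a\sigma_{a+1}\cdots\sigma_{a+r-1}\in B_n$, and $\Gamma_n^r\le B_n$ is the subgroup generated by all the basic $(r+1)^{st}$ twists $\Sigma_{a;r}$. $B_n$ acts on $(\mathbb Z/r\mathbb Z)^n$ (standard basis $e_1,\dots,e_n$) on the left by permuting coordinates via the quotient $B_n\to S_n$, $\sigma_i\mapsto(i\ \,i+1)$. The map $\phi_r:B_n\to(\mathbb Z/r\mathbb Z)^n$ is the crossed homomorphism for this action, i.e. $\phi_r(\alpha\beta)=\phi_r(\alpha)+\alpha\cdot\phi_r(\beta)$, determined by $\phi_r(\sigma_i)=e_{i+1}$ for $1\le i\le n-1$; and $\ker(\phi_r)=\{\beta\in B_n:\phi_r(\beta)=0\}$.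
   Formalization: With φ_r(σ_i)=e_{i+1} and the stated cocycle rule, φ_r(Σ_{a;r})=e_{a+1}+…+e_{a+r}≠0, so the equality fails; the formal theorem uses φ_r(σ_i)=e_i instead, giving φ_r(Σ_{a;r})=r·e_a=0. *)

(* Defs.v *)
From HB Require Import structures.
From mathcomp Require Import all_boot all_order all_algebra all_fingroup.
From mathcomp Require Import boolp classical_sets.
From mathcomp Require Import zify.

Set Implicit Arguments.
Unset Strict Implicit.
Unset Printing Implicit Defensive.

Import GRing.Theory.

(* Strands are numbered from 0, so the standard generator sigma_k of B_n
   (1 <= k <= n - 1) has index k - 1 in 'I_n.-1.  The letter (i, false) stands
   for a generator and (i, true) for its inverse. *)
Definition braid_word (n : nat) := seq ('I_n.-1 * bool).

Definition letter_inv n (l : 'I_n.-1 * bool) : 'I_n.-1 * bool := (l.1, ~~ l.2).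

Inductive braid_eq n : braid_word n -> braid_word n -> Prop :=
| braid_eq_refl u : braid_eq u u
| braid_eq_sym u v : braid_eq u v -> braid_eq v u
| braid_eq_trans v u w : braid_eq u v -> braid_eq v w -> braid_eq u w
| braid_eq_cat u u' v v' :
    braid_eq u u' -> braid_eq v v' -> braid_eq (u ++ v) (u' ++ v')
| braid_eq_cancel l : braid_eq [:: l; letter_inv l] [::]
| braid_eq_far (i j : 'I_n.-1) : (i.+1 < j)%N ->
    braid_eq [:: (i, false); (j, false)] [:: (j, false); (i, false)]
| braid_eq_adj (i j : 'I_n.-1) : i.+1 = j ->
    braid_eq [:: (i, false); (j, false); (i, false)]
             [:: (j, false); (i, false); (j, false)].

Definition braid_eqb n : rel (braid_word n) := fun u v => `[< braid_eq u v >].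

Lemma braid_eqb_refl n : reflexive (@braid_eqb n).
Proof. by move=> u; apply/asboolP; apply: braid_eq_refl. Qed.

Lemma braid_eqb_sym n : symmetric (@braid_eqb n).
Proof. by move=> u v; apply/asboolP/asboolP; apply: braid_eq_sym. Qed.

Lemma braid_eqb_trans n : transitive (@braid_eqb n).
Proof.
move=> v u w /asboolP uv /asboolP vw.
by apply/asboolP; apply: braid_eq_trans uv vw.
Qed.

Canonical braid_equiv n := EquivRel (@braid_eqb n)
  (@braid_eqb_refl n) (@braid_eqb_sym n) (@braid_eqb_trans n).

Definition braid (n : nat) : Type := {eq_quot @braid_equiv n}%qT.

HB.instance Definition _ n := Choice.on (braid n).

Section BraidGroup.
Variable n : nat.
Local Open Scope quotient_scope.

Definition braid_class (u : braid_word n) : braid n :=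
  \pi_{eq_quot @braid_equiv n} u.
Definition braid_repr (x : braid n) : braid_word n :=
  generic_quotient.repr (x : {eq_quot @braid_equiv n}).

Lemma braid_reprK x : braid_class (braid_repr x) = x.
Proof. exact: reprK. Qed.

Lemma braid_classP u v : braid_class u = braid_class v <-> braid_eq u v.
Proof.
split=> [/eqmodP/asboolP // | uv].
by apply/eqmodP/asboolP.
Qed.

Lemma braid_repr_class u : braid_eq (braid_repr (braid_class u)) u.
Proof. by apply/braid_classP; rewrite braid_reprK. Qed.

Definition word_inv (u : braid_word n) : braid_word n :=
  rev [seq letter_inv l | l <- u].

Definition braid_one : braid n := braid_class [::].
Definition braid_mul (x y : braid n) : braid n :=
  braid_class (braid_repr x ++ braid_repr y).
Definition braid_inv (x : braid n) : braid n :=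
  braid_class (word_inv (braid_repr x)).

Lemma letter_invK : involutive (@letter_inv n).
Proof. by case=> i b; rewrite /letter_inv /= negbK. Qed.

Lemma word_invK : involutive word_inv.
Proof.
move=> u; rewrite /word_inv map_rev revK -map_comp.
by rewrite (eq_map (g := id)) ?map_id // => l /=; rewrite letter_invK.
Qed.

Lemma word_mulV u : braid_eq (u ++ word_inv u) [::].
Proof.
elim: u => [|l u IHu]; first exact: braid_eq_refl.
have -> : (l :: u) ++ word_inv (l :: u)
    = [:: l] ++ ((u ++ word_inv u) ++ [:: letter_inv l]).
  by rewrite /word_inv /= rev_cons -cats1 catA.
apply: (braid_eq_trans (v := [:: l] ++ ([::] ++ [:: letter_inv l]))).
  apply: braid_eq_cat; first exact: braid_eq_refl.
  by apply: braid_eq_cat => //; apply: braid_eq_refl.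
exact: braid_eq_cancel.
Qed.

Lemma word_mulVl u : braid_eq (word_inv u ++ u) [::].
Proof. by rewrite -{2}[u]word_invK; apply: word_mulV. Qed.

Lemma braid_mulE u v : braid_mul (braid_class u) (braid_class v) = braid_class (u ++ v).
Proof. by apply/braid_classP; apply: braid_eq_cat; apply: braid_repr_class. Qed.

Lemma braid_mulA : associative braid_mul.
Proof.
move=> x y z; rewrite -(braid_reprK x) -(braid_reprK y) -(braid_reprK z).
by rewrite !braid_mulE catA.
Qed.

Lemma braid_mul1 : left_id braid_one braid_mul.
Proof. by move=> x; rewrite -(braid_reprK x) braid_mulE. Qed.

Lemma braid_mulr1 : right_id braid_one braid_mul.
Proof. by move=> x; rewrite -(braid_reprK x) braid_mulE cats0. Qed.

Lemma braid_mulV : left_inverse braid_one braid_inv braid_mul.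
Proof.
move=> x; rewrite -{2}(braid_reprK x) braid_mulE.
by apply/braid_classP/word_mulVl.
Qed.

Lemma braid_mulrV : right_inverse braid_one braid_inv braid_mul.
Proof.
move=> x; rewrite -{1}(braid_reprK x) braid_mulE.
by apply/braid_classP/word_mulV.
Qed.

End BraidGroup.

HB.instance Definition _ n := isGroup.Build (braid n)
  (@braid_mulA n) (@braid_mul1 n) (@braid_mulr1 n) (@braid_mulV n)
  (@braid_mulrV n).

Definition sigma n (i : 'I_n.-1) : braid n := braid_class [:: (i, false)].

(* The twist Sigma_{a;r} = sigma_a sigma_{a+1} ... sigma_{a+r-1}: the product is
   taken in increasing order of i, and i.+1 is the 1-based index of sigma i. *)
Definition twist n (a r : nat) : braid n :=
  (\prod_(i < n.-1 | (a <= i.+1 < a + r)%N) sigma i)%g.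

Definition basic_twists (n r : nat) : set (braid n) :=
  [set x | exists a : nat, [/\ (1 <= a)%N, (a + r <= n)%N & x = twist n a r]].
Arguments basic_twists : clear implicits.

Definition is_subgroup (G : groupType) (H : set G) : Prop :=
  [/\ H 1%g, (forall x y, H x -> H y -> H (x * y)%g)
    & (forall x, H x -> H x^-1%g)].

Definition gen_subgroup (G : groupType) (S : set G) : set G :=
  smallest (@is_subgroup G) S.

Definition Gamma (n r : nat) : set (braid n) := gen_subgroup (basic_twists n r).
Arguments Gamma : clear implicits.

Section CrossedHom.
Variables n r : nat.
Local Open Scope ring_scope.

Definition strand_l (i : 'I_n.-1) : 'I_n := widen_ord (leq_pred n) i.

Lemma strand_r_subproof (i : 'I_n.-1) : (i.+1 < n)%N.
Proof. by case: n i => [|m] []. Qed.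
Definition strand_r (i : 'I_n.-1) : 'I_n := Ordinal (strand_r_subproof i).

Definition letter_perm (l : 'I_n.-1 * bool) : 'S_n :=
  tperm (strand_l l.1) (strand_r l.1).

Definition word_perm (u : braid_word n) : 'S_n :=
  (\prod_(l <- u) letter_perm l)%g.

Definition braid_perm (x : braid n) : 'S_n := word_perm (braid_repr x).

(* Let pi be the image of x under the homomorphism to the permutations of the
   strands composed as functions.  MathComp composes permutations from left to
   right, so braid_perm x = pi^-1; as (col_perm s v) 0 j = v 0 (s j), braid_act
   is the left action sending e_j to e_{pi(j)}. *)
Definition braid_act (x : braid n) (v : 'rV['Z_r]_n) : 'rV['Z_r]_n :=
  col_perm (braid_perm x) v.

Definition evec (j : 'I_n) : 'rV['Z_r]_n := delta_mx 0 j.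

(* phi is the crossed homomorphism phi (x * y) = phi x + braid_act x (phi y)
   with phi sigma_i = e_i (phiM, phi_sigma); its value on the inverse of a
   generator is forced by phi 1 = 0.  Under this rule, sigma_i |-> e_{i+1} would
   send the twist sigma_a ... sigma_{a+r-1} to e_{a+1} + ... + e_{a+r} rather
   than to r e_a = 0, so the twists would not lie in the kernel.  The value
   e_{i+1} belongs with the rule psi (x * y) = psi y + braid_act y^-1 (psi x),
   solved by psi x = - phi x^-1 (phiV_mul, phiV_sigma), which has the same
   kernel as phi. *)
Definition letter_phi (l : 'I_n.-1 * bool) : 'rV['Z_r]_n :=
  if l.2 then - col_perm (letter_perm l) (evec (strand_l l.1))
  else evec (strand_l l.1).

Fixpoint word_phi (u : braid_word n) : 'rV['Z_r]_n :=
  if u is l :: u' then letter_phi l + col_perm (letter_perm l) (word_phi u')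
  else 0.

Definition phi (x : braid n) : 'rV['Z_r]_n := word_phi (braid_repr x).

Definition ker_phi : set (braid n) := [set x | phi x = 0].

Lemma word_perm_cat u v : word_perm (u ++ v) = (word_perm u * word_perm v)%g.
Proof. exact: big_cat. Qed.

Lemma word_phi_cat u v :
  word_phi (u ++ v) = word_phi u + col_perm (word_perm u) (word_phi v).
Proof.
elim: u => [|l u IHu] /=; first by rewrite /word_perm big_nil col_perm1 add0r.
by rewrite IHu /word_perm big_cons col_permM linearD addrA.
Qed.

Lemma letter_permV l : letter_perm (letter_inv l) = letter_perm l.
Proof. by []. Qed.

Lemma col_perm_evec (s : 'S_n) j : col_perm s (evec j) = evec (s^-1%g j).
Proof.
apply/rowP => k; rewrite !mxE eqxx /=.
by rewrite -[in RHS](inj_eq (@perm_inj _ s)) permKV.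
Qed.

Lemma strand_lr i : strand_l i != strand_r i.
Proof. by rewrite -val_eqE /= neq_ltn ltnSn. Qed.

Lemma braid_eq_inv u v : braid_eq u v ->
  word_perm u = word_perm v /\ word_phi u = word_phi v.
Proof.
elim=> {u v} [//|u v _ [-> ->] //|v u w _ [-> ->] _ [-> ->] //| | | | ].
- move=> u u' v v' _ [pu fu] _ [pv fv].
  by rewrite !word_perm_cat !word_phi_cat pu fu pv fv.
- move=> l; rewrite /word_perm !big_cons big_nil /= letter_permV mulg1 tperm2.
  split=> //; rewrite linear0 addr0 /letter_phi /= letter_permV.
  case: l => i [] /=; first by rewrite addrC subrr.
  by rewrite linearN /= -col_permM tperm2 col_perm1 subrr.
- move=> i j ij; rewrite /word_perm !big_cons big_nil /= !mulg1.
  rewrite !linear0 !addr0 /letter_phi /= !col_perm_evec /letter_perm /= !tpermV.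
  have [n1 n2 n3 n4] : [/\ strand_l i != strand_l j, strand_l i != strand_r j,
      strand_r i != strand_l j & strand_r i != strand_r j].
    by rewrite -!val_eqE /=; split; apply/eqP => E; move: ij; rewrite ?E; lia.
  have [m1 m2 m3 m4] : [/\ strand_l j != strand_l i, strand_r j != strand_l i,
      strand_l j != strand_r i & strand_r j != strand_r i].
    by split; rewrite eq_sym.
  rewrite !tpermD //; split; last by rewrite addrC.
  by rewrite conjgC tpermJ !tpermD.
- move=> i j ij; rewrite /word_perm !big_cons big_nil /= !mulg1.
  rewrite !linear0 !addr0 /letter_phi /=.
  have Er : strand_r i = strand_l j by apply/val_inj.
  have [n1 n2 n3] : [/\ strand_l i != strand_l j, strand_l j != strand_r j
      & strand_l i != strand_r j].
    by rewrite -!val_eqE /=; split; apply/eqP; lia.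
  have [m1 m2 m3] : [/\ strand_l j != strand_l i, strand_r j != strand_l j
      & strand_r j != strand_l i].
    by split; rewrite eq_sym.
  rewrite !linearD /= !col_perm_evec /letter_perm /= !tpermV Er.
  rewrite !tpermR !(tpermD m1 m3) tpermL; split; last by rewrite addrA addrC.
  rewrite (conjgC (tperm (strand_l j) _)) (conjgC (tperm (strand_l i) _) (tperm (strand_l j) _)).
  by rewrite !tpermJ !mulgA !tperm2 tpermL tpermR !tpermD.
Qed.

Lemma braid_perm_class u : braid_perm (braid_class u) = word_perm u.
Proof. by have [] := braid_eq_inv (braid_repr_class u). Qed.

Lemma phi_class u : phi (braid_class u) = word_phi u.
Proof. by have [] := braid_eq_inv (braid_repr_class u). Qed.

Lemma braid_permM x y : braid_perm (x * y)%g = (braid_perm x * braid_perm y)%g.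
Proof. by rewrite [(x * y)%g]/(braid_mul x y) braid_perm_class word_perm_cat. Qed.

Lemma braid_perm_sigma i :
  braid_perm (sigma i) = tperm (strand_l i) (strand_r i).
Proof.
by rewrite braid_perm_class /word_perm big_cons big_nil mulg1.
Qed.

Lemma braid_act_evec i j :
  braid_act (sigma i) (evec j) = evec (tperm (strand_l i) (strand_r i) j).
Proof. by rewrite /braid_act braid_perm_sigma col_perm_evec tpermV. Qed.

Lemma braid_act1 v : braid_act 1%g v = v.
Proof.
by rewrite /braid_act [1%g]/(braid_one n) braid_perm_class /word_perm big_nil col_perm1.
Qed.

Lemma braid_actM x y v : braid_act (x * y)%g v = braid_act x (braid_act y v).
Proof. by rewrite /braid_act braid_permM col_permM. Qed.

Lemma braid_actD x u v : braid_act x (u + v) = braid_act x u + braid_act x v.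
Proof. exact: linearD. Qed.

Lemma phiM x y : phi (x * y)%g = phi x + braid_act x (phi y).
Proof. by rewrite [(x * y)%g]/(braid_mul x y) phi_class word_phi_cat. Qed.

Lemma phi_sigma i : phi (sigma i) = evec (strand_l i).
Proof. by rewrite phi_class /= linear0 addr0. Qed.

Lemma phiV_mul x y :
  - phi (x * y)^-1%g = - phi y^-1%g + braid_act y^-1%g (- phi x^-1%g).
Proof. by rewrite invgM phiM opprD /braid_act linearN. Qed.

Lemma phiV_sigma i : - phi (sigma i)^-1%g = evec (strand_r i).
Proof.
have: phi ((sigma i)^-1 * sigma i)%g = 0.
  by rewrite mulVg [1%g]/(braid_one n) phi_class.
rewrite phiM phi_sigma => /eqP; rewrite addr_eq0 => /eqP ->; rewrite opprK.
have <- : braid_act (sigma i) (evec (strand_r i)) = evec (strand_l i).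
  by rewrite braid_act_evec tpermR.
by rewrite -braid_actM mulVg braid_act1.
Qed.

End CrossedHom.
Arguments phi {n} r x.
Arguments ker_phi : clear implicits.

Definition n0 (r d : nat) : nat :=
  if r == 2%N then 8%N
  else if odd r then ((6 + d) * r)%N else ((12 + d) * r)%N.

(* Main.v *)
(* B_n acts on the labels v in (Z/r)^n by x.v = phi x + x v, and ker phi is the
   stabilizer of 0.  It is enough to show that, modulo Gamma on the right, a
   braid is determined by the label x.0.  If v vanishes on the last strands, it
   has the representative S_(m-1, v_(m-1)) ... S_(0, v_0), where
   S_(a, k) = sigma_a ... sigma_(a+k-1) drags a strand k steps to the left, and
   sigma_i permutes these representatives modulo Gamma because the shift
   relation S_(a, k) S_(b, l) = S_(b+1, l) S_(a, k) holds for a <= b and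
   b + l < a + k, while any exponent can be raised by r.  Hence
   Gamma contains every braid of ker phi on the first n - 2r + 2 strands and, by
   symmetry, on the last ones.  For general labels, write x = g h with g on the
   strands before t and h on the strands from t on; strand t can be moved from h
   to g, since dragging a strand to t from the right through c strands or from
   the left through r - c strands differs by an element of Gamma. *)
Require Import Defs.
From mathcomp Require Import all_boot all_algebra all_fingroup.
From mathcomp Require Import boolp classical_sets.
From mathcomp Require Import zify.

Set Implicit Arguments.
Unset Strict Implicit.
Unset Printing Implicit Defensive.

Import GRing.Theory.
Local Open Scope group_scope.

(** * Words in indexed generators and their values in a group *)

Definition supported (a b : nat) (u : seq (nat * bool)) :=
  all (fun l => a <= l.1 < b)%N u.

Definition inv_letter (l : nat * bool) := (l.1, ~~ l.2).
Definition inv_word (u : seq (nat * bool)) := rev (map inv_letter u).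
Definition twist_word (a k : nat) : seq (nat * bool) :=
  [seq (i, false) | i <- iota a k].

Lemma supportedW a b a' b' u : (a' <= a)%N -> (b <= b')%N ->
  supported a b u -> supported a' b' u.
Proof. by move=> ha hb; apply: sub_all => l; lia. Qed.

Lemma supported_cat a b u w :
  supported a b (u ++ w) = supported a b u && supported a b w.
Proof. exact: all_cat. Qed.

Lemma supported_inv a b u : supported a b (inv_word u) = supported a b u.
Proof. by rewrite /supported /inv_word all_rev all_map. Qed.

Lemma supported_twist a k b c : (b <= a)%N -> (a + k <= c)%N ->
  supported b c (twist_word a k).
Proof.
by move=> ha hk; rewrite /supported all_map; apply/allP => i; rewrite mem_iota /=; lia.
Qed.

Section Eval.
Variables (G : groupType) (s : nat -> G).

Definition eval_letter (l : nat * bool) : G := if l.2 then (s l.1)^-1 else s l.1.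
Definition eval (u : seq (nat * bool)) : G := \prod_(l <- u) eval_letter l.

Lemma eval_nil : eval [::] = 1. Proof. exact: big_nil. Qed.
Lemma eval_cons l u : eval (l :: u) = eval_letter l * eval u.
Proof. exact: big_cons. Qed.
Lemma eval_cat u w : eval (u ++ w) = eval u * eval w.
Proof. exact: big_cat. Qed.

Lemma eval_inv u : eval (inv_word u) = (eval u)^-1.
Proof.
elim: u => [|l u IH]; first by rewrite eval_nil invg1.
rewrite /inv_word /= rev_cons -cats1 eval_cat IH !eval_cons eval_nil mulg1 invgM.
by congr (_ * _); rewrite /eval_letter /=; case: l.2; rewrite //= invgK.
Qed.

Lemma eval_commute x u : (forall l, l \in u -> commute x (s l.1)) ->
  commute x (eval u).
Proof.
elim: u => [|l u IH] h; first by rewrite eval_nil; apply: commute1.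
rewrite eval_cons; apply: commuteM; last first.
  by apply: IH => k hk; apply: h; rewrite inE hk orbT.
rewrite /eval_letter; have hl : commute x (s l.1) by apply: h; rewrite inE eqxx.
by case: l.2 => //; apply: commuteV.
Qed.

End Eval.

(** * Left cosets of a subgroup *)

Section CosetEq.
Variables (G : groupType) (H : set G).
Hypothesis subH : is_subgroup H.

(** This is [x H = y H]: left cosets survive multiplication on the left, the side on which letters
    are added to a word. *)
Definition coset_eq (x y : G) : Prop := H (x^-1 * y).

Lemma coset_eq_refl x : coset_eq x x.
Proof. by rewrite /coset_eq mulVg; case: subH. Qed.

Lemma coset_eq_sym x y : coset_eq x y -> coset_eq y x.
Proof.
by move=> h; rewrite /coset_eq -[x in _ * x]invgK -invgM; case: subH => _ _; apply.
Qed.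

Lemma coset_eq_trans y x z : coset_eq x y -> coset_eq y z -> coset_eq x z.
Proof.
move=> h1 h2; rewrite /coset_eq.
have -> : x^-1 * z = x^-1 * y * (y^-1 * z) by rewrite mulgA mulgK.
by case: subH => _ h _; apply: h.
Qed.

Lemma coset_eqMl z x y : coset_eq (z * x) (z * y) <-> coset_eq x y.
Proof. by rewrite /coset_eq invgM -mulgA mulKg. Qed.

Lemma coset_eq1 x : coset_eq x 1 -> H x.
Proof. by move/coset_eq_sym; rewrite /coset_eq invg1 mul1g. Qed.

End CosetEq.

(** An arbitrary family in a group is allowed, with relations asked only below [N], so that the
    results apply both to the braid generators and to their mirror images. *)
Definition braid_rel (G : groupType) (N : nat) (s : nat -> G) : Prop :=
  (forall i j, (i.+1 < j < N)%N -> commute (s i) (s j)) /\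
  (forall i, (i.+1 < N)%N -> s i * s i.+1 * s i = s i.+1 * s i * s i.+1).

(** * Shift relations between twists *)

Section Twists.
Variables (G : groupType) (N : nat) (s : nat -> G).
Hypothesis braid_s : braid_rel N s.

Local Notation S a k := (eval s (twist_word a k)).

Lemma twistD a k l : S a (k + l) = S a k * S (a + k) l.
Proof. by rewrite /twist_word iotaD map_cat eval_cat. Qed.

Lemma twist1 a : S a 1 = s a.
Proof. by rewrite /twist_word /= eval_cons eval_nil mulg1. Qed.

Lemma twistS a k : S a k.+1 = s a * S a.+1 k.
Proof. by rewrite -add1n twistD twist1 addn1. Qed.

Lemma far_commute i j : (i.+1 < j)%N || (j.+1 < i)%N -> (i < N)%N -> (j < N)%N ->
  commute (s i) (s j).
Proof.
case: braid_s => far _ /orP[] hij hi hj; first by apply: far; lia.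
by apply/commute_sym/far; lia.
Qed.

Lemma supported_commute a b c d u w : supported a b u -> supported c d w ->
  (b < c)%N -> (d <= N)%N -> commute (eval s u) (eval s w).
Proof.
move=> /allP hu /allP hw hbc hd; apply: eval_commute => l /hw /= hl.
apply: commute_sym; apply: eval_commute => k /hu /= hk.
by apply: far_commute; lia.
Qed.

Lemma twist_far a k i : (a + k <= N)%N -> (i < N)%N ->
  (i.+1 < a)%N || (a + k < i)%N -> commute (s i) (S a k).
Proof.
move=> hk hi hai; apply: eval_commute => l /mapP[j]; rewrite mem_iota => hj -> /=.
by apply: far_commute; lia.
Qed.

(** Split [S a k] into a head, [s i], [s i.+1] and a tail: the new [s i] commutes with the tail, the
    braid relation turns it into [s i.+1], and this commutes with the head. *)
Lemma twist_shift1 a k i : (a + k <= N)%N -> (a <= i)%N -> (i.+1 < a + k)%N ->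
  S a k * s i = s i.+1 * S a k.
Proof.
move=> hk hai hik.
have -> : k = (i - a + (k - (i - a).+2).+2)%N by lia.
rewrite twistD !twistS subnKC //.
have c1 : commute (s i) (S i.+2 (k - (i - a).+2)) by apply: twist_far; lia.
have c2 : commute (s i.+1) (S a (i - a)) by apply: twist_far; lia.
rewrite !mulgA c2 -!mulgA -c1 !mulgA -(mulgA _ (s i) (s i.+1)).
congr (_ * _); rewrite -!mulgA; congr (_ * _); rewrite !mulgA.
by case: braid_s => _ -> //; lia.
Qed.

Lemma twist_shift a k b l : (a + k <= N)%N -> (a <= b)%N -> (b + l < a + k)%N ->
  S a k * S b l = S b.+1 l * S a k.
Proof.
move=> hk; elim: l b => [|l IH] b hab hbl.
  by rewrite /twist_word /= eval_nil mulg1 mul1g.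
by rewrite !twistS mulgA twist_shift1 ?IH -?mulgA ?IH //; lia.
Qed.

End Twists.

(** * The affine action on labels *)

Section Labels.
Variable p : nat.
Local Notation r := p.+2.
Local Open Scope ring_scope.

Definition label := nat -> 'Z_r.

(* The affine action v |-> phi sigma_i + sigma_i v: the pair (a, b) in positions
   i, i+1 becomes (b + 1, a). *)
Definition act_letter (l : nat * bool) (v : label) : label := fun j =>
  if j == l.1 then (if l.2 then v l.1.+1 else v l.1.+1 + 1)
  else if j == l.1.+1 then (if l.2 then v l.1 - 1 else v l.1) else v j.

Definition act (u : seq (nat * bool)) (v : label) : label := foldr act_letter v u.

Definition label0 : label := fun=> 0.

Lemma act_cat u w v : act (u ++ w) v = act u (act w v).
Proof. exact: foldr_cat. Qed.

Lemma act_here l v : act_letter l v l.1 = if l.2 then v l.1.+1 else v l.1.+1 + 1.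
Proof. by rewrite /act_letter eqxx. Qed.

Lemma act_next l v : act_letter l v l.1.+1 = if l.2 then v l.1 - 1 else v l.1.
Proof. by rewrite /act_letter eqxx gtn_eqF. Qed.

Lemma act_far l v j : j != l.1 -> j != l.1.+1 -> act_letter l v j = v j.
Proof. by rewrite /act_letter => /negPf -> /negPf ->. Qed.

Lemma label_ext i (f g : label) : f i = g i -> f i.+1 = g i.+1 ->
  (forall j, j != i -> j != i.+1 -> f j = g j) -> f = g.
Proof.
move=> h1 h2 h3; apply/funext => j.
by have [->|hj] := eqVneq j i; last have [->|hj'] := eqVneq j i.+1; auto.
Qed.

Lemma act_letterK l v : act_letter (inv_letter l) (act_letter l v) = v.
Proof.
apply: (@label_ext l.1) => [||j h1 h2].
- by rewrite (act_here (inv_letter l)) act_next /=; case: l.2; rewrite ?subrK.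
- by rewrite (act_next (inv_letter l)) act_here /=; case: l.2; rewrite ?addrK.
- by rewrite !act_far.
Qed.

Lemma act_invK u v : act (inv_word u) (act u v) = v.
Proof.
elim: u v => [//|l u IH] v.
by rewrite /inv_word /= rev_cons -cats1 act_cat /= act_letterK IH.
Qed.

(** The letter [i] touches positions [i] and [i.+1], so letters in [[a, b)] reach position [b] as
    well. *)
Lemma act_outside a b u v j : supported a b u -> (j < a)%N || (b < j)%N ->
  act u v j = v j.
Proof.
move=> hu hj; elim: u hu => [//|[i c] u IH] /= /andP[hl /IH <-].
by rewrite act_far //=; lia.
Qed.

Lemma act_local a b u v v' : supported a b u ->
  (forall j, (a <= j <= b)%N -> v j = v' j) ->
  forall j, (a <= j <= b)%N -> act u v j = act u v' j.
Proof.
move=> + hv; elim: u => [//|[i c] u IH] /= /andP[hl /IH {}IH] j hj.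
have [->|h1] := eqVneq j i; first by rewrite !(act_here (i, c)) /= !IH //; lia.
have [->|h2] := eqVneq j i.+1; first by rewrite !(act_next (i, c)) /= !IH //; lia.
by rewrite !act_far ?IH.
Qed.

Lemma act_twist a k v : act (twist_word a k) v = fun j =>
  if j == a then v (a + k)%N + k%:R
  else if (a < j <= a + k)%N then v j.-1 else v j.
Proof.
elim: k a => [|k IH] a.
  apply/funext => j /=; rewrite addn0 addr0; case: eqP => [->|_] //.
  by case: ifP => //; lia.
rewrite /twist_word /= -/(twist_word _ _) IH; apply: (@label_ext a) => [||j h1 h2].
- by rewrite act_here /= !eqxx addSnnS -addrA natr1.
- rewrite (act_next (a, false)) /= ltn_eqF // gtn_eqF //=.
  by rewrite ltnNge leqnSn /= ifT //; lia.
- rewrite act_far //= (negPf h1) (negPf h2) addSnnS.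
  by congr (if _ then _ else _); lia.
Qed.

Lemma act_twist_full a v j :
  act (twist_word a r) v j = if j == a then v (a + r)%N
  else if (a < j <= a + r)%N then v j.-1 else v j.
Proof. by rewrite act_twist pchar_Zp // addr0. Qed.

Definition label1 (i : nat) : label := fun j => (j == i)%:R.

(* sigma_i ^ 2 translates every label by e_i + e_(i+1), and on a label v
   sigma_i followed by (v_i - v_(i+1)) (e_i - e_(i+1)) amounts to adding e_i. *)
Section Transitivity.
Variables a b : nat.

Definition reachable (v : label) := exists2 u, supported a b u & act u label0 = v.

Definition translates (d : label) :=
  forall v, reachable v -> reachable (fun j => v j + d j).

Lemma reachable_act u v : supported a b u -> reachable v -> reachable (act u v).
Proof.
move=> hu [w hw <-]; exists (u ++ w); first by rewrite supported_cat hu.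
by rewrite act_cat.
Qed.

Lemma translates_add d d' : translates d -> translates d' ->
  translates (fun j => d j + d' j).
Proof.
move=> hd hd' v hv; have := hd' _ (hd _ hv).
by congr reachable; apply/funext => j; rewrite addrA.
Qed.

Lemma translates0 : translates (fun=> 0).
Proof. by move=> v; congr reachable; apply/funext => j; rewrite addr0. Qed.

Lemma translates_scale d (c : 'Z_r) : translates d -> translates (fun j => c * d j).
Proof.
move=> hd.
suff h k : translates (fun j => k%:R * d j) by have := h c; rewrite natr_Zp.
elim: k => [|k IH].
  by have := translates0; congr translates; apply/funext => j; rewrite mul0r.
have := translates_add hd IH; congr translates.
by apply/funext => j; rewrite mulrS mulrDl mul1r.
Qed.

Lemma translatesN d : translates d -> translates (fun j => - d j).
Proof.
move=> /(@translates_scale _ (-1)); congr translates.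
by apply/funext => j; rewrite mulN1r.
Qed.

Lemma translates_adj i : (a <= i < b)%N ->
  translates (fun j => label1 i j + label1 i.+1 j).
Proof.
move=> hi v hv.
have hu : supported a b [:: (i, false); (i, false)] by rewrite /= hi.
have := reachable_act hu hv; congr reachable.
apply: (@label_ext i) => [||j h1 h2] /=; rewrite /label1.
- by rewrite act_here /= (act_next (i, false)) /= eqxx ltn_eqF // addr0.
- by rewrite (act_next (i, false)) /= act_here /= eqxx gtn_eqF // add0r.
- by rewrite !act_far // (negPf h1) (negPf h2) !addr0.
Qed.

(** Conjugating [sigma_(i+1)^2] by [sigma_i] moves one of its two strands from position [i.+1] to
    position [i]. *)
Lemma translates_skip i : (a <= i)%N -> (i.+1 < b)%N ->
  translates (fun j => label1 i j + label1 i.+2 j).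
Proof.
move=> hi hb v hv.
have hu : supported a b
    [:: (i, false); (i.+1, false); (i.+1, false); (i, true)].
  by rewrite /= hi hb; lia.
have := reachable_act hu hv; congr reachable; apply/funext => j /=.
have neqs : ((i == i.+1) = false) * ((i == i.+2) = false) * ((i.+1 == i.+2) = false)
    * ((i.+1 == i) = false) * ((i.+2 == i) = false) * ((i.+2 == i.+1) = false).
  by do ![split]; lia.
rewrite /act_letter /label1 /= !(neqs, eqxx).
have [->|h1] := eqVneq j i; first by rewrite !neqs subrK addr0.
have [->|h2] := eqVneq j i.+1; first by rewrite !neqs !addr0.
by have [->|h3] := eqVneq j i.+2; rewrite ?add0r ?addr0.
Qed.

Lemma translates_of_diff i : (a <= i < b)%N ->
  translates (fun j => label1 i j - label1 i.+1 j) -> translates (label1 i).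
Proof.
move=> hi hd v hv.
have hu : supported a b [:: (i, false)] by rewrite /= hi.
have := translates_scale (v i - v i.+1) hd (reachable_act hu hv).
congr reachable; apply: (@label_ext i) => [||j h1 h2] /=; rewrite /label1.
- by rewrite act_here /= eqxx ltn_eqF // subr0 mulr1 addrC addrA subrK.
- rewrite (act_next (i, false)) /= eqxx gtn_eqF // sub0r addr0 mulrN mulr1.
  by rewrite subKr.
- by rewrite act_far // (negPf h1) (negPf h2) subrr mulr0.
Qed.

(** Three neighbouring positions provide all pairwise sums; a difference of two sums is
    [e_i - e_(i+1)], whence [e_i], and subtracting it from the sums gives the other two. *)
Lemma translates1 x : (a <= x <= b)%N -> (a + 2 <= b)%N -> translates (label1 x).
Proof.
move=> hx hab.
have ext d d' : d =1 d' -> translates d -> translates d' by move/funext ->.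
(* A window of three positions around [x]: it starts at [a] near the left end and otherwise ends at
   [x]. *)
have [i [hi hib hix]] : exists i, [/\ (a <= i)%N, (i.+1 < b)%N & (i <= x <= i.+2)%N].
  have [h|h] := leqP (a + 2) x; last by exists a; split; lia.
  by exists (x - 2)%N; split; lia.
have t01 : translates (fun j => label1 i j + label1 i.+1 j).
  by apply: translates_adj; lia.
have t12 : translates (fun j => label1 i.+1 j + label1 i.+2 j).
  by apply: translates_adj; lia.
have t02 := translates_skip hi hib.
have e0 : translates (label1 i).
  apply: translates_of_diff; first lia.
  by apply: ext (translates_add t02 (translatesN t12)) => j;
    rewrite opprD addrACA subrr addr0 addrC.
have e1 : translates (label1 i.+1).
  by apply: ext (translates_add t01 (translatesN e0)) => j; rewrite addrC addrA addNr add0r.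
have e2 : translates (label1 i.+2).
  by apply: ext (translates_add t02 (translatesN e0)) => j; rewrite addrC addrA addNr add0r.
have [->//|h0] := eqVneq x i; have [->//|h1] := eqVneq x i.+1.
by have -> : x = i.+2 by lia.
Qed.

Lemma reachable_all v : (a + 2 <= b)%N ->
  (forall j, (j < a)%N || (b < j)%N -> v j = 0) -> reachable v.
Proof.
move=> hab hv.
(* The labels are set one position at a time, from [a] upwards. *)
suff h k : translates (fun j => if (a <= j < a + k)%N && (j <= b)%N then v j else 0).
  have r0 : reachable label0 by exists [::].
  have := h (b - a).+1 _ r0; congr reachable; apply/funext => j; rewrite add0r.
  by case: ifP => // hj; rewrite hv //; lia.
elim: k => [|k IH].
  by have := translates0; congr translates; apply/funext => j; case: ifP => //; lia.
have [hk|hk] := leqP (a + k) b; last first.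
  have := IH; congr translates; apply/funext => j.
  by congr (if _ then _ else _); lia.
have hx : (a <= a + k <= b)%N by lia.
have := translates_add IH (translates_scale (v (a + k)%N) (translates1 hx hab)).
congr translates; apply/funext => j; rewrite /label1.
have [->|hj] := eqVneq j (a + k)%N.
  by rewrite mulr1 ifF ?ifT ?add0r //; lia.
by rewrite mulr0 addr0; congr (if _ then _ else _); lia.
Qed.

End Transitivity.
End Labels.

(** * Normal forms modulo [H] when there is room on the right *)

Section OneSided.
Variables (p N : nat) (G : groupType) (s : nat -> G) (H : set G).
Local Notation r := p.+2.
Local Notation S a k := (eval s (twist_word a k)).
Hypotheses (braid_s : braid_rel N s) (subH : is_subgroup H)
  (twistH : forall a, (a + r <= N)%N -> H (S a r)).
Local Notation "x ~~ y" := (coset_eq H x y) (at level 70).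

(** Applied to [label0], the factor of index [m'] drags an unlabelled strand to position [m'], where
    it arrives with label [v m']. The exponents are the representatives below [r]. *)
Fixpoint normal_form (m : nat) (v : label p) : G :=
  if m is m'.+1 then S m' (v m') * normal_form m' v else 1.

Lemma normal_formS m v : normal_form m.+1 v = S m (v m) * normal_form m v.
Proof. by []. Qed.

Arguments normal_form : simpl never.

Lemma normal_form_eq m v v' : (forall j, (j < m)%N -> v j = v' j) ->
  normal_form m v = normal_form m v'.
Proof.
by elim: m => [//|m IH] h; rewrite !normal_formS h // IH // => j hj; apply: h; lia.
Qed.

Lemma normal_form0 m : normal_form m (@label0 p) = 1.
Proof. by elim: m => [//|m IH]; rewrite normal_formS IH eval_nil mulg1. Qed.

(* Lengthening the twist S m c past the end of S a r, at the cost of the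
   element S (m + c) r, turns the product into one to which twist_shift applies. *)
Lemma normal_form_fixed m a v : (m + 2 * r <= N + 2)%N -> (m <= a)%N ->
  (a + r <= N)%N -> S a r * normal_form m v ~~ normal_form m v.
Proof.
elim: m a => [|m IH] a hm ha haN; last rewrite normal_formS.
  by rewrite mulg1; apply: coset_eq_sym => //; rewrite /coset_eq invg1 mul1g; apply: twistH.
set c := val (v m); have hc : (c < r)%N by apply: (ltn_ord (v m)).
have [hac|hac] := leqP a (m + c); last first.
  have -> : S a r * (S m c * normal_form m v) = S m c * (S a r * normal_form m v).
    rewrite !mulgA; congr (_ * _); apply: commute_sym.
    apply: (supported_commute braid_s (a := m) (b := (m + c)%N) (c := a) (d := N));
      by rewrite ?supported_twist.
  by apply/coset_eqMl; apply: IH; lia.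
(* As [c <= r - 1], the bound [m.+1 + 2 * r <= N + 2] gives exactly the room [m + c + r <= N] that
   the added twist needs. *)
have lengthen : S m (c + r) * normal_form m v ~~ S m c * normal_form m v.
  by rewrite twistD -mulgA; apply/coset_eqMl; apply: IH; lia.
apply: (coset_eq_trans subH (y := S a r * (S m (c + r) * normal_form m v))).
  by apply/coset_eqMl; apply: coset_eq_sym.
apply: (coset_eq_trans subH _ lengthen).
(* Since [m < a <= m + c], passing the long twist lowers the index of [S a r] by one and keeps it at
   least [m]. *)
have -> : S a r * (S m (c + r) * normal_form m v)
    = S m (c + r) * (S a.-1 r * normal_form m v).
  rewrite !mulgA; congr (_ * _); rewrite (twist_shift braid_s (b := a.-1)) ?prednK //; lia.
by apply/coset_eqMl; apply: IH; lia.
Qed.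

Lemma val_Zp_succ (b : 'Z_r) : (b + 1)%R = (if b.+1 == r then 0 else b.+1) :> nat.
Proof.
rewrite /= modnDmr addn1; case: eqP => [->|h]; first by rewrite modnn.
by rewrite modn_small //; move: (ltn_ord b) h; rewrite /Zp_trunc /=; lia.
Qed.

(** Factors of index above [i.+1] commute with [s i]. On the two top factors, with exponents [b] and
    [a], [s i] lengthens the first to [S i b.+1], and the shift relation exchanges it with
    [S i a]. *)
Lemma normal_form_gen m i v : (m + 2 * r <= N + 3)%N -> (i.+1 < m)%N ->
  s i * normal_form m v ~~ normal_form m (act_letter (i, false) v).
Proof.
elim: m => [//|m IH] hm; rewrite ltnS leq_eqVlt => /orP[/eqP him|him].
  subst m; rewrite !normal_formS.
  have -> : act_letter (i, false) v i = (v i.+1 + 1)%R by exact: act_here.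
  have -> : act_letter (i, false) v i.+1 = v i by exact: act_next.
  have -> : normal_form i (act_letter (i, false) v) = normal_form i v.
    by apply: normal_form_eq => j hj; rewrite act_far //=; lia.
  rewrite val_Zp_succ.
  set q := normal_form i v; set a := val (v i); set b := val (v i.+1).
  have ha : (a < r)%N by apply: (ltn_ord (v i)).
  have hb : (b < r)%N by apply: (ltn_ord (v i.+1)).
  have swap k : (a <= k)%N -> (i + k.+1 <= N)%N ->
      s i * (S i.+1 k * (S i a * q)) = S i.+1 a * (S i k.+1 * q).
    move=> hak hk; rewrite !mulgA -twistS.
    by rewrite (twist_shift braid_s) //; lia.
  have [hab|hab] := leqP a b.
    rewrite swap //; last by lia.
    (* If [b.+1 = r], the new label wraps around to 0 and the factor [S i r] is absorbed by
       [normal_form_fixed]. *)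
    apply/coset_eqMl; case: eqP => [->|_]; last exact: coset_eq_refl.
    by rewrite eval_nil mul1g; apply: normal_form_fixed; lia.
  rewrite ifF; last by lia.
  (* The shift relation needs [a <= b]; here [b] is raised by [r] to allow the exchange, and the
     excess is stripped off afterwards. *)
  have fix1 : S i.+1 (b + r) * (S i a * q) ~~ S i.+1 b * (S i a * q).
    rewrite twistD -mulgA; apply/coset_eqMl.
    by apply: (@normal_form_fixed i.+1 _ v); lia.
  apply: (coset_eq_trans subH (y := s i * (S i.+1 (b + r) * (S i a * q)))).
    by apply/coset_eqMl; apply: coset_eq_sym.
  rewrite swap; try lia.
  apply/coset_eqMl; rewrite -addSn twistD -mulgA; apply/coset_eqMl.
  by apply: normal_form_fixed; lia.
have -> : normal_form m.+1 (act_letter (i, false) v)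
    = S m (v m) * normal_form m (act_letter (i, false) v).
  by rewrite normal_formS act_far //=; lia.
have -> : s i * normal_form m.+1 v = S m (v m) * (s i * normal_form m v).
  rewrite normal_formS !mulgA; congr (_ * _); apply: (twist_far braid_s); last lia.
    by have : (v m < r)%N := ltn_ord (v m); lia.
  by lia.
by apply/coset_eqMl; apply: IH; lia.
Qed.

Lemma normal_form_eval k u v : (k + 2 * r <= N + 2)%N -> supported 0 k u ->
  eval s u * normal_form k.+1 v ~~ normal_form k.+1 (act u v).
Proof.
move=> hk; elim: u v => [|[i e] u IH] v /=.
  by move=> _; rewrite eval_nil mul1g; apply: coset_eq_refl.
move=> /andP[hi hu]; rewrite eval_cons -mulgA.
apply: (coset_eq_trans subH); first by apply/coset_eqMl; apply: IH.
case: e; rewrite /eval_letter /=; last by apply: normal_form_gen; lia.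
(* An inverse letter is the step of the generator read backwards, from the label already moved. *)
apply/(coset_eqMl _ (s i)); rewrite mulVKg; apply: coset_eq_sym => //.
rewrite -{2}(act_letterK (i, true) (act u v)).
by apply: normal_form_gen; lia.
Qed.

(** The normal form of [label0] is 1, so each braid is congruent to the normal form of its own
    label. *)
Lemma one_sided k u w : (k + 2 * r <= N + 2)%N -> supported 0 k u ->
  supported 0 k w -> act u (@label0 p) = act w (@label0 p) ->
  eval s u ~~ eval s w.
Proof.
move=> hk hu hw huw.
have := normal_form_eval (@label0 p) hk hu.
have := normal_form_eval (@label0 p) hk hw.
rewrite huw normal_form0 !mulg1 => h2 h1.
by apply: (coset_eq_trans subH h1); apply: coset_eq_sym.
Qed.

End OneSided.

(** * Reflection of the strands *)

Section Mirror.
Variables (p N : nat) (G : groupType) (s : nat -> G).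
Local Notation r := p.+2.

(* sigma_i |-> sigma_(N-1-i)^-1 is an automorphism of the braid group; it maps
   basic twists to inverses of basic twists. *)
Definition mirror_gen (i : nat) : G := (s (N.-1 - i)%N)^-1.
Definition mirror_letter (l : nat * bool) := ((N.-1 - l.1)%N, ~~ l.2).
(** There are [N] generators but [N.+1] strands, hence [N - j]; the sign reflects the inversion of
    generators. Past [N], truncated subtraction would repeat [v 0], so 0 is imposed. *)
Definition mirror_label (v : label p) : label p :=
  fun j => if (j <= N)%N then (- v (N - j)%N)%R else 0%R.

Lemma braid_rel_mirror : braid_rel N s -> braid_rel N mirror_gen.
Proof.
case=> far adj; split=> [i j hij|i hi]; rewrite /mirror_gen.
  by apply: commuteV; apply: commute_sym; apply: commuteV; apply: far; lia.
have -> : (N.-1 - i = (N.-1 - i.+1).+1)%N by lia.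
by rewrite -!invgM !mulgA adj //; lia.
Qed.

Lemma eval_mirror u : supported 0 N u ->
  eval mirror_gen (map mirror_letter u) = eval s u.
Proof.
elim: u => [|[i e] u IH] /=; first by rewrite !eval_nil.
move=> /andP[hi hu]; rewrite !eval_cons IH //; congr (_ * _).
rewrite /eval_letter /mirror_gen /=; have -> : (N.-1 - (N.-1 - i) = i)%N by lia.
by case: e; rewrite //= invgK.
Qed.

Lemma supported_mirror a b u : (b <= N)%N -> supported a b u ->
  supported (N - b) (N - a) (map mirror_letter u).
Proof.
by move=> hb; rewrite /supported all_map; apply: sub_all => -[i e] /=; lia.
Qed.

(** A pair [(x, y)] reflects to [(-y, -x)]; its image [(y + 1, x)] reflects to [(-x, -y - 1)], which
    is what the inverse letter makes of [(-y, -x)]. *)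
Lemma act_mirror u v : supported 0 N u ->
  act (map mirror_letter u) (mirror_label v) = mirror_label (act u v).
Proof.
elim: u => [//|[i e] u IH] /= /andP[hi /IH ->].
have e1 : (N - (N.-1 - i).+1 = i)%N by lia.
have e2 : (N - (N.-1 - i) = i.+1)%N by lia.
have [l1 l2] : (N.-1 - i <= N)%N /\ ((N.-1 - i).+1 <= N)%N by lia.
apply: (@label_ext _ (N.-1 - i)) => [||j h1 h2].
- rewrite (act_here (mirror_letter (i, e))) /mirror_label /= l1 l2 e1 e2.
  by rewrite (act_next (i, e)) /=; case: e => //=; rewrite opprB addrC.
- rewrite (act_next (mirror_letter (i, e))) /mirror_label /= l1 l2 e1 e2.
  by rewrite (act_here (i, e)) /=; case: e => //=; rewrite opprD.
- rewrite (act_far (l := mirror_letter (i, e))) // /mirror_label.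
  by case: ifP => // hj; rewrite act_far //=; lia.
Qed.

Lemma mirror_twist a k : (a + k <= N)%N ->
  eval mirror_gen (twist_word a k) = (eval s (twist_word (N - a - k) k))^-1.
Proof.
elim: k a => [|k IH] a hk; first by rewrite !eval_nil invg1.
rewrite twistS IH; last by lia.
have -> : (N - a - k.+1 = N - a.+1 - k)%N by lia.
rewrite -[k.+1]addn1 twistD twist1 invgM /mirror_gen; congr ((s _)^-1 * _); lia.
Qed.

End Mirror.

(** * Braids cut at a strand [t] *)

Section TwoSided.
Variables (p N : nat) (G : groupType) (s : nat -> G) (H : set G).
Local Notation r := p.+2.
Local Notation S a k := (eval s (twist_word a k)).
Hypotheses (braid_s : braid_rel N s) (subH : is_subgroup H)
  (twistH : forall a, (a + r <= N)%N -> H (S a r)).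
Local Notation "x ~~ y" := (coset_eq H x y) (at level 70).

Lemma other_sided t u w : (2 * r <= t + 2)%N -> supported t N u ->
  supported t N w -> act u (@label0 p) = act w (@label0 p) ->
  eval s u ~~ eval s w.
Proof.
move=> ht hu hw huw.
have hu0 : supported 0 N u by apply: supportedW hu.
have hw0 : supported 0 N w by apply: supportedW hw.
have m0 : mirror_label N (@label0 p) = @label0 p.
  by apply/funext => j; rewrite /mirror_label oppr0 if_same.
rewrite -(eval_mirror s hu0) -(eval_mirror s hw0).
(* When [N < t], [N - t] truncates to 0 and the bound of [one_sided] could fail, but then both words
   are empty. *)
have [Nt|tN] := ltnP N t.
  have nil z : supported t N z -> z = [::].
    by case: z => [//|l z] /= /andP[hl _]; exfalso; lia.
  by rewrite (nil _ hu) (nil _ hw); apply: coset_eq_refl.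
apply: (@one_sided p N _ _ _ (braid_rel_mirror braid_s) subH _ (N - t)).
- move=> a ha; rewrite mirror_twist //; case: subH => _ _; apply.
  by apply: twistH; lia.
- lia.
- by rewrite -(subnn N); apply: supported_mirror.
- by rewrite -(subnn N); apply: supported_mirror.
- by rewrite -m0 !act_mirror // huw.
Qed.

(** The first two bounds give [one_sided] on strands [0] to [t] and [other_sided] on strands [t] to
    [N]; the last two leave at least three strands strictly on each side of [t], as [reachable_all]
    requires. *)
Variable t : nat.
Hypotheses (t_small : (t + 2 * r <= N + 2)%N) (t_large : (2 * r <= t + 2)%N)
  (t_ge3 : (3 <= t)%N) (t_le : (t + 3 <= N)%N).

Local Notation lbl u := (act u (@label0 p)).

Lemma act_commute a b c d u w (v : label p) : supported a b u ->
  supported c d w -> (b < c)%N -> act u (act w v) = act w (act u v).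
Proof.
move=> hu hw hbc; apply/funext => j.
have [hj|hj] := boolP (a <= j <= b)%N.
  rewrite (act_outside (act u v) hw); last lia.
  by apply: (act_local hu) => // i hi; rewrite (act_outside v hw) //; lia.
rewrite (act_outside _ hu); last lia.
have [hj'|hj'] := boolP (c <= j <= d)%N; last first.
  by rewrite !(act_outside _ hw) ?(act_outside _ hu) //; lia.
by apply: (act_local hw) => // i hi; rewrite (act_outside _ hu) //; lia.
Qed.

(* The same label can be given to strand t by dragging a strand to it from
   either side. *)
Lemma two_sided_strand (c : 'Z_r) : exists kl kr,
  [/\ supported 0 t kl, supported t N kr, eval s kr ~~ eval s kl,
      lbl kl = lbl kr & lbl kr = fun j => if j == t then c else 0%R].
Proof.
have hc : (c < r)%N := ltn_ord c.
exists (inv_word (twist_word (t - (r - c)) (r - c))), (twist_word t c).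
(* The inverse of the left word followed by the right one is a basic twist. It lies in [H] and fixes
   [label0], which gives both the coset equality and the equality of labels. *)
have e : twist_word (t - (r - c)) (r - c) ++ twist_word t c
    = twist_word (t - (r - c)) r.
  rewrite /twist_word -map_cat; congr map.
  have -> : iota t c = iota (t - (r - c) + (r - c)) c by congr iota; lia.
  by rewrite -iotaD; congr iota; lia.
split.
- by rewrite supported_inv; apply: supported_twist; lia.
- by apply: supported_twist; lia.
- apply: coset_eq_sym => //; rewrite /coset_eq eval_inv invgK -eval_cat e.
  by apply: twistH; lia.
- rewrite -[RHS](act_invK (twist_word (t - (r - c)) (r - c))).
  rewrite -[act (twist_word _ _) (act _ _)]act_cat e.
  by congr act; apply/funext => j; rewrite act_twist_full !if_same.
- by rewrite act_twist; apply/funext => j; rewrite if_same natr_Zp add0r.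
Qed.

(** Modulo [H], [x] is a product of braids on disjoint blocks of strands; strand [t] belongs to the
    right block here and to the left block in [glued']. *)
Definition glued (x : G) (v : label p) := exists g h,
  [/\ supported 0 t.-1 g, supported t N h, x ~~ eval s (g ++ h)
    & lbl (g ++ h) = v].

Definition glued' (x : G) (v : label p) := exists g h,
  [/\ supported 0 t g, supported t.+1 N h, x ~~ eval s (g ++ h)
    & lbl (g ++ h) = v].

(** On disjoint blocks the label of the product restricts to the labels of the factors, and each
    factor is determined modulo [H] by its own label. *)
Lemma glued_uniq x y v : glued x v -> glued y v -> x ~~ y.
Proof.
move=> [g [h [hg hh xgh <-]]] [g' [h' [hg' hh' ygh]]].
rewrite !act_cat => e.
have left g1 h1 : supported 0 t.-1 g1 -> supported t N h1 ->
    forall j, (j < t)%N -> act g1 (lbl h1) j = lbl g1 j.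
  move=> hg1 hh1 j hj; apply: (act_local hg1); last lia.
  by move=> i hi; rewrite (act_outside _ hh1) //; lia.
have right g1 h1 : supported 0 t.-1 g1 -> forall j, (t <= j)%N ->
    act g1 (lbl h1) j = lbl h1 j.
  by move=> hg1 j hj; rewrite (act_outside _ hg1) //; lia.
have eg : lbl g = lbl g'.
  apply/funext => j; have [hj|hj] := ltnP j t.
    by rewrite -(left g h) // -(left g' h') // e.
  by rewrite (act_outside _ hg) ?(act_outside _ hg') //; lia.
have eh : lbl h = lbl h'.
  apply/funext => j; have [hj|hj] := ltnP j t; last first.
    by rewrite -(right g h) // -(right g' h') // e.
  by rewrite (act_outside _ hh) ?(act_outside _ hh') //; lia.
apply: (coset_eq_trans subH xgh); apply: coset_eq_sym => //.
apply: (coset_eq_trans subH ygh); rewrite !eval_cat.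
apply: (coset_eq_trans subH (y := eval s g' * eval s h)).
  by apply/coset_eqMl; apply: (other_sided t_large).
(* Only the rightmost factor may be changed modulo [H], so the left block is commuted to the
   right. *)
have cm z : supported 0 t.-1 z -> eval s z * eval s h = eval s h * eval s z.
  by move=> hz; apply: (supported_commute braid_s hz hh); lia.
rewrite !cm //; apply/coset_eqMl.
apply: (one_sided braid_s subH twistH t_small); last by [].
  by apply: supportedW hg'; lia.
by apply: supportedW hg; lia.
Qed.

(** Replace [h] by [h' kr], where [kr] provides the label of strand [t] and [h'] the labels beyond
    it; then trade [kr] for [kl], which commutes with [h'] and joins [g]. *)
Lemma gluedW x v : glued x v -> glued' x v.
Proof.
move=> [g [h [hg hh xgh <-]]].
have [kl [kr [hkl hkr ek lk lkr]]] := two_sided_strand (lbl h t).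
have [h' hh' lh'] : reachable t.+1 N (fun j => if (j <= t)%N then 0%R else lbl h j).
  apply: reachable_all; first lia.
  by move=> j hj; case: ifP => // tj; rewrite (act_outside _ hh) //; lia.
have lh : lbl h = lbl (h' ++ kr).
  rewrite act_cat lkr; apply/funext => j.
  have [hj|hj] := leqP j t.
    rewrite (act_outside _ hh'); last lia.
    by case: eqP => [->//|hjt]; rewrite (act_outside _ hh) //; lia.
  have [jN|jN] := leqP j N; last first.
    by rewrite (act_outside _ hh') /= ?gtn_eqF ?(act_outside _ hh) //; lia.
  rewrite (act_local (v' := @label0 p) hh'); last lia.
    by rewrite lh' leqNgt hj.
  by move=> i hi; rewrite gtn_eqF //; lia.
have hgkl : supported 0 t (g ++ kl).
  by rewrite supported_cat hkl andbT; apply: supportedW hg; lia.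
exists (g ++ kl), h'; split=> //.
  apply: (coset_eq_trans subH xgh); rewrite -catA !eval_cat; apply/coset_eqMl.
  rewrite (supported_commute braid_s hkl hh') //.
  apply: (coset_eq_trans subH (y := eval s (h' ++ kr))).
    apply: (other_sided t_large) => //; rewrite supported_cat hkr andbT.
    exact: supportedW hh'.
  by rewrite eval_cat; apply/coset_eqMl.
by rewrite act_cat (act_commute _ hgkl hh') // !act_cat lh act_cat -lk
  (act_commute _ (supportedW (leqnn 0) (leq_pred t) hg) hh').
Qed.

(** The same exchange in the other direction: [g] becomes [g' kl], and [kr] joins [h]. *)
Lemma gluedW' x v : glued' x v -> glued x v.
Proof.
move=> [g [h [hg hh xgh <-]]].
have [kl [kr [hkl hkr ek lk lkr]]] := two_sided_strand (lbl g t).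
have [g' hg' lg'] : reachable 0 t.-1 (fun j => if (j < t)%N then lbl g j else 0%R).
  apply: reachable_all; first lia.
  by move=> j hj; case: ifP => // tj; lia.
have lg : lbl g = lbl (g' ++ kl).
  rewrite act_cat lk lkr; apply/funext => j.
  have [hj|hj] := ltnP j t.
    rewrite (act_local (v' := @label0 p) hg'); last lia.
      by rewrite lg' hj.
    by move=> i hi; rewrite ltn_eqF //; lia.
  rewrite (act_outside _ hg'); last lia.
  by case: eqP => [->//|hjt]; rewrite (act_outside _ hg) //; lia.
have hhkr : supported t N (h ++ kr).
  by rewrite supported_cat hkr andbT; apply: supportedW hh.
have hg't : supported 0 t g' by apply: supportedW hg'; lia.
exists g', (h ++ kr); split=> //.
  apply: (coset_eq_trans subH xgh); rewrite catA !eval_cat.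
  rewrite (supported_commute braid_s hg hh) //.
  rewrite (supported_commute braid_s hg't hh) // -mulgA; apply/coset_eqMl.
  apply: (coset_eq_trans subH (y := eval s (g' ++ kl))).
    by apply: (one_sided braid_s subH twistH t_small) => //; rewrite supported_cat hkl andbT.
  by rewrite eval_cat; apply/coset_eqMl; apply: coset_eq_sym.
by rewrite !act_cat (act_commute _ hg't hh) // (act_commute _ hg hh) // lg
  act_cat lk.
Qed.

(** The letter [t.-1] mixes the two blocks of [glued] but lies in the left block of [glued'];
    letters below [t] are therefore added there, the others directly to [h]. *)
Lemma glued_letter l x v : (l.1 < N)%N -> glued x v ->
  glued (eval_letter s l * x) (act_letter l v).
Proof.
move=> lN xv; have [lt|lt] := ltnP l.1 t.
  apply: gluedW'; have [g [h [hg hh xgh <-]]] := gluedW xv.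
  exists (l :: g), h; split=> //; first by rewrite /= lt.
  by rewrite cat_cons eval_cons; apply/coset_eqMl.
have [g [h [hg hh xgh <-]]] := xv.
have hlh : supported t N (l :: h) by rewrite /= lt lN.
have hl : supported t N [:: l] by rewrite /= lt lN.
exists g, (l :: h); split=> //.
  rewrite eval_cat eval_cons mulgA.
  have := supported_commute braid_s hg hl; rewrite eval_cons eval_nil mulg1 => ->; try lia.
  by rewrite -mulgA -eval_cat; apply/coset_eqMl.
by rewrite -cat1s !act_cat (act_commute _ hg hl) //; lia.
Qed.

Lemma glued_eval u : supported 0 N u -> glued (eval s u) (lbl u).
Proof.
elim: u => [_|l u IH] /=.
  by exists [::], [::]; split=> //; apply: coset_eq_refl.
by move=> /andP[hl /IH hu]; rewrite eval_cons; apply: glued_letter.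
Qed.

(** The braid and 1 are both glued with label 0, hence lie in the same coset. *)
Lemma two_sided u : supported 0 N u -> lbl u = @label0 p -> H (eval s u).
Proof.
move=> hu lu; apply: (coset_eq1 subH).
have := glued_eval hu; rewrite lu => gu.
by rewrite -(eval_nil s); apply: glued_uniq gu _; apply: (glued_eval (u := [::])).
Qed.

End TwoSided.

Lemma gen_subgroup_is_subgroup (G : groupType) (A : set G) :
  is_subgroup (gen_subgroup A).
Proof.
split=> [|x y hx hy|x hx].
- by move=> M /= [[]].
- move=> M /= hM; have [[_ h _] _] := hM.
  exact: h (hx M hM) (hy M hM).
- by move=> M /= hM; have [[_ _ h] _] := hM; apply: h (hx M hM).
Qed.

(** * Return to the braid group and the crossed homomorphism *)

Section Braids.
Variable n : nat.

(** The value 1 out of range is a mere default: [braid_rel n.-1] constrains only indices below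
    [n.-1]. *)
Definition gen (i : nat) : braid n :=
  if insub i is Some o then sigma o else 1.

Definition nat_word (u : braid_word n) : seq (nat * bool) :=
  [seq (val l.1, l.2) | l <- u].

Lemma gen_sigma (i : 'I_n.-1) : gen i = sigma i.
Proof. by rewrite /gen valK. Qed.

Lemma supported_nat_word u : supported 0 n.-1 (nat_word u).
Proof. by rewrite /supported all_map; apply/allP => l _ /=. Qed.

Lemma braid_class_cons l u :
  @braid_class n (l :: u) = @braid_class n [:: l] * braid_class u.
Proof. by rewrite -cat1s -braid_mulE. Qed.

Lemma eval_nat_word u : eval gen (nat_word u) = braid_class u.
Proof.
elim: u => [|[i e] u IH]; first exact: eval_nil.
rewrite /= eval_cons IH braid_class_cons; congr (_ * _).
rewrite /eval_letter /= gen_sigma; case: e => //.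
apply: mulg1_eq; rewrite -braid_class_cons.
by apply/braid_classP/braid_eq_cancel.
Qed.

Lemma gen_braid_rel : braid_rel n.-1 gen.
Proof.
split=> [i j hij|i hi].
  have hi : (i < n.-1)%N by lia.
  have hj : (j < n.-1)%N by lia.
  rewrite -[i]/(val (Ordinal hi)) -[j]/(val (Ordinal hj)) !gen_sigma.
  have /braid_classP : @braid_eq n _ _ :=
    @braid_eq_far n (Ordinal hi) (Ordinal hj) (proj1 (andP hij)).
  by rewrite !(@braid_class_cons _ [:: _]).
have hi' : (i < n.-1)%N by lia.
rewrite -[i.+1]/(val (Ordinal hi)) -[i]/(val (Ordinal hi')) !gen_sigma.
have /braid_classP : @braid_eq n _ _ :=
  @braid_eq_adj n (Ordinal hi') (Ordinal hi) erefl.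
by rewrite !(@braid_class_cons _ [:: _; _]) !(@braid_class_cons _ [:: _]) !mulgA.
Qed.

Lemma twist_eval a k : (a + k <= n.-1)%N ->
  twist n a.+1 k = eval gen (twist_word a k).
Proof.
move=> hk; rewrite /eval big_map /eval_letter /=.
have -> : iota a k = index_iota a (a + k) by rewrite /index_iota addKn.
rewrite (big_nat_widenl a 0) // (big_nat_widen 0 _ n.-1) // big_mkord.
by apply: eq_big => [i|i _]; rewrite ?gen_sigma //=; lia.
Qed.

Lemma act_nat_word p u (j : 'I_n) :
  act (nat_word u) (@label0 p) j = word_phi p.+2 u 0%R j.
Proof.
elim: u j => [|[i e] u IH] j; first by rewrite /= mxE.
have evE k : evec p.+2 k 0%R j = ((j == k)%:R)%R :> 'Z_p.+2 by rewrite mxE eqxx.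
rewrite [word_phi _ _]/= [nat_word _]/= [act _ _]/= mxE.
have -> : letter_phi p.+2 (i, e) 0%R j
    = (if e then - (j == strand_r i)%:R else (j == strand_l i)%:R)%R.
  rewrite /letter_phi /=; case: e; last exact: evE.
  by rewrite mxE col_perm_evec tpermV tpermL evE.
rewrite [col_perm _ _ _ _]mxE /letter_perm /=.
have nlr := strand_lr i.
have [->|h1] := eqVneq j (strand_l i).
  rewrite tpermL -IH (act_here (val i, e)) (negPf nlr) /=.
  by case: e; rewrite ?oppr0 ?add0r // addrC.
have [->|h2] := eqVneq j (strand_r i).
  rewrite tpermR -IH (act_next (val i, e)) /=.
  by case: e; rewrite ?add0r // addrC.
rewrite tpermD; try by rewrite eq_sym.
rewrite act_far //= -IH.
by case: e; rewrite ?oppr0 add0r.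
Qed.

Lemma phi_eq0P p u :
  phi p.+2 (braid_class u) = 0%R <-> act (nat_word u) (@label0 p) = @label0 p.
Proof.
rewrite phi_class; split=> [h|h]; last first.
  by apply/rowP => j; rewrite -act_nat_word h mxE.
apply/funext => j; have [hj|hj] := ltnP j n.
  by rewrite -[j]/(val (Ordinal hj)) act_nat_word h mxE.
(* For [n = 0], [n <= j] does not give [n.-1 < j]; a nonempty word excludes this, since a letter
   forces [2 <= n]. *)
have [-> //|lu] := eqVneq u [::].
rewrite (act_outside _ (supported_nat_word u)) //.
by case: u lu {h} => [//|[[k hk] e] u _]; lia.
Qed.

Lemma ker_phi_subgroup r : is_subgroup (ker_phi n r).
Proof.
have ker1 : phi r (1 : braid n) = 0%R by rewrite phi_class.
rewrite /ker_phi /=; split=> [//|x y hx hy|x hx] /=.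
  by rewrite phiM hx hy add0r /braid_act linear0.
have := phiM r x x^-1; rewrite mulgV ker1 hx add0r.
move/(congr1 (braid_act x^-1)); rewrite -braid_actM mulVg braid_act1.
by rewrite /braid_act linear0.
Qed.

Lemma nat_word_surj w : supported 0 n.-1 w -> exists u, nat_word u = w.
Proof.
elim: w => [|[i e] w IH] /=; first by exists [::].
by move=> /andP[hi /IH[u <-]]; exists ((Ordinal hi, e) :: u).
Qed.

(** A full twist permutes the labels and adds [r = 0] to one of them, so it fixes [label0]. *)
Lemma phi_twist p a : (a + p.+2 <= n.-1)%N -> phi p.+2 (twist n a.+1 p.+2) = 0%R.
Proof.
move=> ha; rewrite twist_eval //.
have [u hu] : exists u, nat_word u = twist_word a p.+2.
  exact/nat_word_surj/supported_twist.
rewrite -hu eval_nat_word; apply/phi_eq0P; rewrite hu.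
by apply/funext => j; rewrite act_twist_full !if_same.
Qed.

End Braids.

Theorem theorem6p10 (n r : nat) (hn : (3 <= n)%N) (hr : (2 <= r)%N)
  (hn0 : (n0 r (n %% 3) <= n)%N) : ker_phi n r = Gamma n r.
Proof.
case: r hr hn0 => [//|[//|p]] _ hn0.
(* With [N = n - 1] and the cut at [t = 2r], these bounds are [t + 2r <= N + 2] and [t + 3 <= N].
   They follow from [8 <= n] when [r = 2] and from [6r <= n] otherwise. *)
have [small large] : (4 * p.+2 <= n + 1)%N /\ (2 * p.+2 + 4 <= n)%N.
  move: hn0; rewrite /n0; case: eqP => [[->]|hp] hn0; first by split; lia.
  suff : (6 * p.+2 <= n)%N by lia.
  by apply: leq_trans hn0; case: ifP => _; rewrite leq_mul2r; lia.
apply/seteqP; split=> [x|]; last first.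
  apply: smallest_sub; first exact: ker_phi_subgroup.
  move=> _ [[|a] [a1 ha ->]] //; rewrite /ker_phi /= phi_twist //; lia.
rewrite -[x]braid_reprK => /phi_eq0P hx; rewrite -eval_nat_word.
apply: (@two_sided p n.-1 _ _ _ (@gen_braid_rel n) _ _ (2 * p.+2)) => //; try lia.
- exact: gen_subgroup_is_subgroup.
- move=> a ha; rewrite -twist_eval //; apply: sub_gen_smallest.
  by exists a.+1; split=> //; lia.
- exact: supported_nat_word.
Qed.
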